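(* Let $K$ be a knot diagram with $N$ crossings whose all-0 resolution has $\ell$ circles, let $n,k\ge 0$ with $n+k=\ell$, and let $Q=Q(G_{n,k}(K))=D+A$ be the signless Laplace matrix of the weighted graph $G_{n,k}(K)$. Then $$Q=\Delta_{0,k-n}(K),$$ where $\Delta_{0,k-n}(K)$ is the Laplacian of the Khovanov complex of $K$ in homological degree $0$ and quantum degree $k-n$, written in the basis of labelled circles.
   Context: Let $V=\mathrm{span}_{\mathbb C}\{\mathbb 1,X\}$ with $\deg\mathbb 1=1$, $\deg X=-1$ and $\{\mathbb 1,X\}$ orthonormal. The degree-$0$ chain space of the Khovanov bracket (no overall degree shifts) of $K$ is $V^{\otimes\ell}$, with one factor per circle of the resolution in which every crossing is 0-smoothed; the quantum degree of a labelling by $k$ symbols $\mathbb 1$ and $n$ symbols $X$ is $k-n$. The differential out of degree $0$ is the direct sum over the $N$ crossings of the map obtained by changing that crossing from its 0-smoothing to its 1-smoothing: if this merges circles $i,j$ it is $m_{ij}$, acting on factors $i,j$ by $\mathbb 1\mathbb 1\mapsto\mathbb 1$, $\mathbb 1X,X\mathbb 1\mapsto X$, $XX\mapsto 0$; if it splits circle $i$ it is $\delta_i$, acting on factor $i$ by $\mathbb 1\mapsto\mathbb 1X+X\mathbb 1$, $X\mapsto XX$. The Laplacian is $$\Delta_0(K)=d_0^\dagger d_0=\sum_{a=1}^{p}\mathfrak m_{i_a,j_a}+\sum_{b=1}^{t}\mathfrak d_{i_b},\qquad p+t=N,$$ where $\mathfrak m_{ij}=m_{ij}^\dagger m_{ij}$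 (one term for each merging crossing) acts by $\mathbb 1\mathbb 1\mapsto\mathbb 1\mathbb 1$, $\mathbb 1X\mapsto\mathbb 1X+X\mathbb 1$, $X\mathbb 1\mapsto\mathbb 1X+X\mathbb 1$, $XX\mapsto0$ on factors $i,j$, and $\mathfrak d_i=\delta_i^\dagger\delta_i$ (one term for each splitting crossing) acts by $\mathbb 1\mapsto2\,\mathbb 1$, $X\mapsto X$ on factor $i$. It preserves quantum degree, and $\Delta_{0,q}(K)$ is its restriction to quantum degree $q$. The weighted graph $G_{n,k}(K)$: vertices are sequences $v=v_1\cdots v_\ell$, indexed by the circles, with $n$ entries $X$ and $k$ entries $\mathbb 1$. For each term $\mathfrak m_{ij}$: add a loop of weight $\frac12$ at each $v$ with $v_i=v_j=\mathbb 1$, and an edge of weight $1$ between each $v$ with $v_iv_j\in\{\mathbb 1X,X\mathbb 1\}$ and the sequence obtained by swapping the entries $i$ and $j$ (one edge per unordered pair). For each term $\mathfrak d_i$: add a loop of weight $\frac12$ at each $v$ with $v_i=X$ and of weight $1$ at each $v$ with $v_i=\mathbb 1$. Weights of repeated edges and repeated loops are added. $A$ is the adjacency matrix with entries the weights $w_{vv'}$ (diagonal entries being loop weights), and $D$ is the diagonal matrix of degrees $d(v)=\sum_{v'}w_{vv'}$, a loop counting once. *)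

(* Defs.v *)
From HB Require Import structures.
From mathcomp Require Import all_fingroup zify.
From mathcomp Require Export reals complex.
From mathcomp Require Export all_boot all_order all_algebra.

Set Implicit Arguments.
Unset Strict Implicit.
Unset Printing Implicit Defensive.

Import Order.TTheory GRing.Theory Num.Theory.

Local Open Scope ring_scope.
Local Open Scope sesquilinear_scope.

(* A knot diagram is given by its planar-diagram code.  The four strand ends at a
   crossing are numbered 0, 1, 2, 3 counterclockwise in such a way that the ends
   0 and 2 belong to the under-strand; [strand_end c i] is the arc that leaves
   crossing [c] at end [i]. *)

Section PlanarDiagramCode.
Variables (N : nat) (arc : finType) (strand_end : 'I_N -> 'Z_4 -> arc).

(* Each arc joins two strand ends.  An arc with no end is a crossingless closed
   curve; it makes the crossingless diagram of the unknot representable. *)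
Definition pd_wf : bool :=
  [forall a, #|[set p | strand_end p.1 p.2 == a]| \in [:: 0%N; 2%N]].

Definition straight_rel : rel arc := fun a b =>
  [exists c, exists i, (strand_end c i == a) && (strand_end c (i + 2) == b)].

Definition pd_knot : bool := n_comp straight_rel predT == 1%N.

(* [face_rel p q]: leave a crossing through the strand end [p], follow the arc to
   its other strand end, and then turn to the neighbouring strand end [q]. *)
Definition face_rel : rel ('I_N * 'Z_4) := fun p q =>
  [exists p' : 'I_N * 'Z_4,
    [&& p' != p, strand_end p'.1 p'.2 == strand_end p.1 p.2
      & q == (p'.1, p'.2 + 1)]].

(* The rotation system has genus 0: a connected 4-valent map with [N > 0]
   vertices has [2 * N] edges, so Euler's formula asks for [N + 2] faces. *)
Definition pd_planar : bool := (0 < N)%N ==> (n_comp face_rel predT == N.+2).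

End PlanarDiagramCode.

Record knot_diagram (N : nat) := KnotDiagram {
  arc : finType;
  strand_end : 'I_N -> 'Z_4 -> arc;
  knot_diagram_wf : pd_wf strand_end;
  knot_diagram_knot : pd_knot strand_end;
  knot_diagram_planar : pd_planar strand_end
}.

Definition state (N : nat) := 'I_N -> bool.

Definition zero_state (N : nat) : state N := fun=> false.
Arguments zero_state : clear implicits.

Definition one_state (N : nat) (c : 'I_N) : state N := fun c' => c' == c.

(* The 0-smoothing joins the ends 0-1 and 2-3 (it merges the two regions swept
   by the over-strand when it is rotated counterclockwise); the 1-smoothing
   joins the ends 0-3 and 1-2. *)
Definition smoothing_mate (b : bool) (i : 'Z_4) : 'Z_4 :=
  if odd i (+) b then i - 1 else i + 1.

Section Resolution.
Variables (N : nat) (K : knot_diagram N) (s : state N).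

Definition smoothing_rel : rel (arc K) := fun a b =>
  [exists c, exists i, (strand_end K c i == a) &&
                       (strand_end K c (smoothing_mate (s c) i) == b)].

Definition component_of (a : arc K) : {set arc K} :=
  [set b | connect smoothing_rel a b].

Definition circle : finType :=
  {B : {set arc K} | B \in [set component_of a | a in arc K]}.

Lemma component_ofP (a : arc K) :
  component_of a \in [set component_of b | b in arc K].
Proof. exact: imset_f. Qed.

Definition circle_of (a : arc K) : circle :=
  exist (fun B => B \in [set component_of b | b in arc K]) _ (component_ofP a).

End Resolution.

(* A chain space is represented by coordinates in its orthonormal basis of
   labelled circles. *)
Variant label := One | X.

Definition bool_of_label (x : label) := if x is One then true else false.
Definition label_of_bool (b : bool) := if b then One else X.
Lemma bool_of_labelK : cancel bool_of_label label_of_bool.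
Proof. by case. Qed.
HB.instance Definition _ := Finite.copy label (can_type bool_of_labelK).

Definition label_deg (x : label) : int := if x is One then 1 else -1.

Definition labelling (N : nat) (K : knot_diagram N) (s : state N) : finType :=
  {ffun circle K s -> label}.

Definition labelling0 (N : nat) (K : knot_diagram N) : finType :=
  labelling K (zero_state N).

(* Basis of the degree-1 chain space, the direct sum over the crossings [c] of
   the spaces of the resolutions where only [c] is 1-smoothed *)
Definition labelling1 (N : nat) (K : knot_diagram N) : finType :=
  {c : 'I_N & labelling K (one_state c)}.

Definition qdeg (N : nat) (K : knot_diagram N) (v : labelling0 K) : int :=
  \sum_i label_deg (v i).

(* Matrices act on column vectors: entry [(w, v)] is the coefficient of the basis
   vector [w] in the image of the basis vector [v]. *)

Section Laplacian.
Variables (C : numClosedFieldType) (N : nat) (K : knot_diagram N).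

(* Coefficient of [z] in m(x (x) y) *)
Definition merge_coef (x y z : label) : C :=
  match x, y, z with
  | One, One, One | One, X, X | X, One, X => 1
  | _, _, _ => 0
  end.

(* Coefficient of [y (x) z] in delta(x) *)
Definition split_coef (x y z : label) : C :=
  match x, y, z with
  | One, One, X | One, X, One | X, X, X => 1
  | _, _, _ => 0
  end.

(* In both smoothings of [c] the ends 0 and 2 lie on different strands, so the
   circles through [c] are those through the ends 0 and 2. *)
Definition circle0_fst (c : 'I_N) := circle_of (zero_state N) (strand_end K c 0).
Definition circle0_snd (c : 'I_N) := circle_of (zero_state N) (strand_end K c 2).
Definition circle1_fst (c : 'I_N) := circle_of (one_state c) (strand_end K c 0).
Definition circle1_snd (c : 'I_N) := circle_of (one_state c) (strand_end K c 2).

Definition merging (c : 'I_N) : bool :=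
  (circle0_fst c != circle0_snd c) && (circle1_fst c == circle1_snd c).

Definition splitting (c : 'I_N) : bool :=
  (circle0_fst c == circle0_snd c) && (circle1_fst c != circle1_snd c).

(* The two labellings agree on the circles that do not pass through [c]. *)
Definition agree_off (c : 'I_N) (v : labelling0 K) (u : labelling K (one_state c))
    : bool :=
  [forall a : arc K,
    (circle_of (zero_state N) a \notin [:: circle0_fst c; circle0_snd c]) ==>
    (u (circle_of (one_state c) a) == v (circle_of (zero_state N) a))].

(* Matrix entries of the edge map of [c].  For a planar diagram every crossing
   is either merging or splitting. *)
Definition edge_coef (c : 'I_N) (v : labelling0 K) (u : labelling K (one_state c))
    : C :=
  if ~~ agree_off v u then 0
  else if merging c then
    merge_coef (v (circle0_fst c)) (v (circle0_snd c)) (u (circle1_fst c))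
  else if splitting c then
    split_coef (v (circle0_fst c)) (u (circle1_fst c)) (u (circle1_snd c))
  else 0.

Definition differential0 : 'M[C]_(#|labelling1 K|, #|labelling0 K|) :=
  \matrix_(i, j) edge_coef (enum_val j) (tagged (enum_val i)).

Definition laplacian0 : 'M[C]_#|labelling0 K| :=
  differential0 ^t* *m differential0.

Definition qbasis (q : int) : {set labelling0 K} := [set v | qdeg v == q].

(* By [laplacian0_qdeg] below, [laplacian0] is block diagonal for the quantum
   degree, so its restriction to quantum degree [q] is this diagonal block. *)
Definition laplacian0_q (q : int) : 'M[C]_#|qbasis q| :=
  \matrix_(i, j) laplacian0 (enum_rank (enum_val i)) (enum_rank (enum_val j)).

Lemma edge_coef_qdeg (c : 'I_N) (v w : labelling0 K)
    (u : labelling K (one_state c)) :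
  edge_coef v u != 0 -> edge_coef w u != 0 -> qdeg v = qdeg w.
Proof.
rewrite /edge_coef /=.
have [av|_] := boolP (agree_off v u); last by rewrite eqxx.
have [aw|_] := boolP (agree_off w u); last by rewrite eqxx.
have vw i : i \notin [:: circle0_fst c; circle0_snd c] -> v i = w i.
  case: i => B BP; have /imsetP [a _ aB] := BP.
  have -> : exist _ B BP = circle_of (zero_state N) a by exact/val_inj.
  move=> na; move: (forallP av a) (forallP aw a); rewrite na /=.
  by move=> /eqP <- /eqP <-.
case: ifPn => [/andP [ij _]|_].
  move=> Hv Hw; rewrite /qdeg.
  rewrite (bigD1 (circle0_fst c)) // (bigD1 (circle0_snd c)) 1?eq_sym //=.
  rewrite [RHS](bigD1 (circle0_fst c)) // [in RHS](bigD1 (circle0_snd c)) 1?eq_sym //=.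
  rewrite !addrA; congr (_ + _); last first.
    by apply: eq_bigr => i /andP [n1 n2]; rewrite vw // !inE negb_or n1.
  move: Hv Hw.
  by case: (v _) => //; case: (v _) => //; case: (u _) => //=;
     rewrite ?eqxx //; case: (w _) => //; case: (w _) => //=; rewrite ?eqxx.
case: ifPn => [/andP [/eqP ij _]|_]; last by rewrite eqxx.
move=> Hv Hw; rewrite /qdeg.
rewrite (bigD1 (circle0_fst c)) // [RHS](bigD1 (circle0_fst c)) //=.
congr (_ + _); last first.
  by apply: eq_bigr => i n1; rewrite vw // !inE -ij orbb n1.
move: Hv Hw.
by case: (v _) => //; case: (u _) => //; case: (u _) => //=;
   rewrite ?eqxx //; case: (w _) => //=; rewrite ?eqxx.
Qed.

Lemma laplacian0_qdeg (v w : labelling0 K) :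
  qdeg v != qdeg w -> laplacian0 (enum_rank v) (enum_rank w) = 0.
Proof.
move=> nvw; rewrite mxE big1 // => e _; rewrite !mxE !enum_rankK.
have [-> |Hv] := eqVneq (edge_coef v (tagged (enum_val e))) 0.
  by rewrite rmorph0 mul0r.
have [-> |Hw] := eqVneq (edge_coef w (tagged (enum_val e))) 0.
  by rewrite mulr0.
by rewrite (edge_coef_qdeg Hv Hw) eqxx in nvw.
Qed.

End Laplacian.

(* The vertices form a subset of a finite type [T]; diagonal weights are loop
   weights. *)

Record wgraph (F : nzRingType) (T : finType) := WGraph {
  vertices : {set T};
  weight : T -> T -> F;
  weight_sym : forall v w, weight v w = weight w v
}.

Section SignlessLaplace.
Variables (F : nzRingType) (T : finType) (G : wgraph F T).

Definition adjacency_mx : 'M[F]_#|vertices G| :=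
  \matrix_(i, j) weight G (enum_val i) (enum_val j).

Definition degree_mx : 'M[F]_#|vertices G| :=
  diag_mx (\row_i \sum_j adjacency_mx i j).

Definition signless_laplace_mx : 'M[F]_#|vertices G| := degree_mx + adjacency_mx.

End SignlessLaplace.

Section KhovanovGraph.
Variables (F : fieldType) (N : nat) (K : knot_diagram N).

Definition nb_label (x : label) (v : labelling0 K) : nat := #|[set i | v i == x]|.

Definition swap (i j : circle K (zero_state N)) (v : labelling0 K) : labelling0 K :=
  [ffun x => v (tperm i j x)].

Definition merge_weight (i j : circle K (zero_state N)) (v w : labelling0 K) : F :=
  match v i, v j with
  | One, One => if w == v then 2^-1 else 0
  | X, X => 0
  | _, _ => if w == swap i j v then 1 else 0
  end.

Definition split_weight (i : circle K (zero_state N)) (v w : labelling0 K) : F :=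
  if w == v then (if v i is One then 1 else 2^-1) else 0.

Definition khovanov_weight (v w : labelling0 K) : F :=
  \sum_(c | merging K c) merge_weight (circle0_fst K c) (circle0_snd K c) v w
  + \sum_(c | splitting K c) split_weight (circle0_fst K c) v w.

Lemma swapK i j : involutive (swap i j).
Proof. by move=> v; apply/ffunP => x; rewrite !ffunE tpermK. Qed.

Lemma merge_weight_sym i j v w : merge_weight i j v w = merge_weight i j w v.
Proof.
rewrite /merge_weight.
have [->|ne] := eqVneq w v; first by [].
have [->|ne2] := eqVneq w (swap i j v).
  by rewrite swapK eqxx !ffunE tpermL tpermR; case: (v i); case: (v j).
have -> : (v == swap i j w) = false.
  by apply/negP => /eqP E; rewrite E swapK eqxx in ne2.
by case: (v i); case: (v j); case: (w i); case: (w j).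
Qed.

Lemma khovanov_weight_sym v w : khovanov_weight v w = khovanov_weight w v.
Proof.
congr (_ + _); apply: eq_bigr => c _; first exact: merge_weight_sym.
by rewrite /split_weight eq_sym; case: eqVneq => // ->.
Qed.

Definition khovanov_graph (n k : nat) : wgraph F (labelling0 K) :=
  WGraph [set v | (nb_label X v == n) && (nb_label One v == k)]
         khovanov_weight_sym.

End KhovanovGraph.

(* The vertices of the graph are the basis vectors of quantum degree [k - n]. *)
Lemma vertices_khovanov_graph (F : fieldType) (N : nat) (K : knot_diagram N)
    (n k : nat) :
  (n + k)%N = #|circle K (zero_state N)| ->
  vertices (khovanov_graph F K n k) = qbasis K (k%:Z - n%:Z).
Proof.
move=> hnk; apply/setP => v; rewrite !inE.
have deg : qdeg v = (nb_label One v)%:Z - (nb_label X v)%:Z.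
  rewrite /qdeg (bigID (fun i => v i == One)) /=; congr (_ + _).
    rewrite (eq_bigr (fun=> 1)) => [|i /eqP -> //].
    by rewrite sumr_const /nb_label cardsE pmulrn intz.
  rewrite (eq_bigr (fun=> -1)) => [|i]; last by case: (v i).
  rewrite sumr_const mulNrn /nb_label cardsE pmulrn intz.
  by congr (- (Posz _)); apply: eq_card => i; rewrite -?topredE /= ?inE; case: (v i).
have tot : (nb_label X v + nb_label One v = n + k)%N.
  rewrite hnk /nb_label -(cardsC [set i | v i == X]); congr (_ + _)%N.
  by apply: eq_card => i; rewrite !inE; case: (v i).
rewrite deg; apply/andP/eqP => [[/eqP -> /eqP ->] //|E].
by split; lia.
Qed.

Lemma card_vertices_khovanov_graph (F : fieldType) (N l n k : nat)
    (K : knot_diagram N) (hl : #|circle K (zero_state N)| = l)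
    (hnk : (n + k)%N = l) :
  #|vertices (khovanov_graph F K n k)| = #|qbasis K (k%:Z - n%:Z)|.
Proof. by rewrite vertices_khovanov_graph // hl. Qed.

(* Main.v *)
Require Import Defs.
From mathcomp Require Import perm.
Import Order.TTheory GRing.Theory Num.Theory.
Local Open Scope ring_scope.

Set Implicit Arguments.
Unset Strict Implicit.
Unset Printing Implicit Defensive.

(** Both matrices are sums over the crossings, so the identity can be checked
one crossing at a time.  The entry [(v, w)] of the Laplacian is the sum over [c]
of [local_laplacian c v w], the Hermitian pairing of the images of [v] and [w]
under the edge map of [c] (lemma [laplacian0_sum]).

Fix [c].  Resmoothing [c] leaves every circle that avoids [c] unchanged
([off_crossing], [eq_circle_off_crossing]), so a labelling of the new resolution
in the support of the edge map of [c] at [v] is the labelling [v] on the old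
circles together with free labels on the one or two circles through [c].  The
pairing thus vanishes unless [v] and [w] agree away from [c], and then it is a
pairing of values of the multiplication or comultiplication of the Frobenius
algebra: an entry of m^* m or of delta^* delta ([local_laplacian_merging],
[local_laplacian_splitting]).

On the graph side, the terms of [c] in D + A are computed by hand.  For a
merging crossing, the vertex [v] has local degree 1/2, 1 or 0 according to its
labels 11, 1X (or X1) and XX on the two circles.  A loop contributes both to A
and to D, which is why its weight is half of the diagonal entry of the
Laplacian; an edge 1X -- X1 contributes 1 to each of the four entries of its
2 x 2 block, which is m^* m on that block ([merge_signless_laplace],
[split_signless_laplace]).  Restricting to a vertex set is harmless for the
degrees because swapping two labels preserves their numbers.  A crossing that
neither merges nor splits contributes zero to both sides. *)

(** * Finite sums and enumerations *)

Lemma big_label (V : nmodType) (F : label -> V) : \sum_x F x = F One + F X.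
Proof.
rewrite (bigD1 One) //=; congr (_ + _).
by rewrite (big_pred1 X) // => -[].
Qed.

Lemma sum_indicator (V : nmodType) (T : finType) (A : {set T}) a (x : V) :
  a \in A -> \sum_(b in A) (if b == a then x else 0) = x.
Proof.
move=> aA; rewrite (bigD1 a) //= eqxx big1 ?addr0 // => b /andP [_ /negPf ba].
by rewrite ba.
Qed.

Lemma addr_half (F : numFieldType) : 2^-1 + 2^-1 = 1 :> F.
Proof. by rewrite -mulr2n -[_ *+ 2]mulr_natl mulfV ?pnatr_eq0. Qed.

Lemma enum_val_cast (T : finType) (A B : {set T}) (eqAB : #|A| = #|B|) i :
  A = B -> enum_val (cast_ord (esym eqAB) i) = enum_val i.
Proof.
move=> AB; subst B; congr (enum_val _); exact/val_inj.
Qed.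

(** * Circles away from a resmoothed crossing *)

Lemma smoothing_mateK b : involutive (smoothing_mate b).
Proof. by case: b => -[[|[|[|[|]]]] //= p]; apply/val_inj. Qed.

Section Surgery.
Variables (N : nat) (K : knot_diagram N).

Lemma smoothing_rel_sym (s : state N) : symmetric (@smoothing_rel N K s).
Proof.
suff sub : forall a b : arc K, smoothing_rel s a b -> smoothing_rel s b a.
  by move=> a b; apply/idP/idP; apply: sub.
move=> a b /existsP [c /existsP [i /andP [ia ib]]].
apply/existsP; exists c; apply/existsP; exists (smoothing_mate (s c) i).
by rewrite smoothing_mateK ia ib.
Qed.

Lemma connect_smoothing_sym (s : state N) : connect_sym (@smoothing_rel N K s).
Proof. exact/sym_connect_sym/smoothing_rel_sym. Qed.

Lemma eq_circle_of (s : state N) (a b : arc K) :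
  (circle_of s a == circle_of s b) = connect (@smoothing_rel N K s) a b.
Proof.
apply/eqP/idP => [/(congr1 val) /= /setP /(_ b)|ab].
  by rewrite !inE connect0 => ->.
apply/val_inj/setP => x; rewrite !inE /=.
exact: (same_connect (connect_smoothing_sym s) ab).
Qed.

Lemma circle_ofP (s : state N) (B : circle K s) : exists a, B = circle_of s a.
Proof.
by case: B => B BP; have /imsetP [a _ aB] := BP; exists a; exact/val_inj.
Qed.

Definition circles_at (s : state N) (c : 'I_N) : seq (circle K s) :=
  [:: circle_of s (strand_end K c 0); circle_of s (strand_end K c 2)].

(** Either smoothing pairs an even end with an odd one, so the circles through
the ends 0 and 2 are all the circles through the crossing. *)
Lemma smoothing_mate_even_end b (i : 'Z_4) :
  (i \in [:: 0; 2]) || (smoothing_mate b i \in [:: 0; 2]).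
Proof. by case: b; case: i => -[|[|[|[|]]]]. Qed.

Lemma mem_circles_at (s : state N) (c : 'I_N) (a : arc K) :
  (circle_of s a \in circles_at s c) =
  [exists i, connect (@smoothing_rel N K s) a (strand_end K c i)].
Proof.
have even_end i : i \in [:: 0; 2] ->
    connect (@smoothing_rel N K s) a (strand_end K c i) ->
    circle_of s a \in circles_at s c.
  by rewrite !inE !eq_circle_of => /orP [] /eqP -> ->; rewrite ?orbT.
apply/idP/existsP => [|[i ai]].
  by rewrite !inE !eq_circle_of => /orP []; [exists 0 | exists 2].
have /orP [|] := smoothing_mate_even_end (s c) i; move/even_end; apply=> //.
apply: connect_trans ai (connect1 _).
by apply/existsP; exists c; apply/existsP; exists i; rewrite !eqxx.
Qed.

(** A path that starts on a circle of [s] avoiding [c] never reaches an end at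
[c]: each of its steps is made at another crossing, where [s] and [t] have the
same smoothing, so the path stays on that circle. *)
Lemma connect_off_crossing_sub (s t : state N) (c : 'I_N) (a b : arc K) :
  (forall c', c' != c -> s c' = t c') ->
  circle_of s a \notin circles_at s c ->
  connect (@smoothing_rel N K t) a b -> connect (@smoothing_rel N K s) a b.
Proof.
rewrite mem_circles_at negb_exists => st /forallP na.
move=> /connectP [p tp ->] {b}.
have: connect (@smoothing_rel N K s) a a by exact: connect0.
elim: p {-2 4}a tp => [|y p IH] x //= /andP [xy tp] ax; apply: IH => //.
have /existsP [c' /existsP [i /andP [/eqP xi /eqP yi]]] := xy.
have cc' : c' != c by apply/eqP => ecc; move: (na i); rewrite -ecc xi ax.
apply: connect_trans ax _; apply: connect1.
apply/existsP; exists c'; apply/existsP; exists i.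
by rewrite (st c' cc') xi yi !eqxx.
Qed.

(** Since [s] and [t] play symmetric roles, this makes the inclusion of circles
in [connect_off_crossing_sub] an equality. *)
Lemma off_crossing (s t : state N) (c : 'I_N) (a : arc K) :
  (forall c', c' != c -> s c' = t c') ->
  circle_of s a \notin circles_at s c -> circle_of t a \notin circles_at t c.
Proof.
move=> st na; apply: contra (na).
rewrite !mem_circles_at => /existsP [i ai]; apply/existsP; exists i.
exact: (connect_off_crossing_sub st na ai).
Qed.

Lemma eq_circle_off_crossing (s t : state N) (c : 'I_N) (a b : arc K) :
  (forall c', c' != c -> s c' = t c') ->
  circle_of s a \notin circles_at s c ->
  (circle_of t a == circle_of t b) = (circle_of s a == circle_of s b).
Proof.
move=> st na; rewrite !eq_circle_of; apply/idP/idP.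
  exact: (connect_off_crossing_sub st na).
by apply: connect_off_crossing_sub (off_crossing st na) => c' /st.
Qed.

Lemma zero_one_state (c c' : 'I_N) :
  c' != c -> zero_state N c' = one_state c c'.
Proof. by move=> /negPf cc'; rewrite /one_state cc'. Qed.

Lemma one_zero_state (c c' : 'I_N) :
  c' != c -> one_state c c' = zero_state N c'.
Proof. by move=> cc'; rewrite -zero_one_state. Qed.

End Surgery.

(** * Labellings that agree away from a crossing *)

Section LocalLabellings.
Variables (N : nat) (K : knot_diagram N) (c : 'I_N).

Notation fst0 := (circle0_fst K c).
Notation snd0 := (circle0_snd K c).
Notation fst1 := (circle1_fst K c).
Notation snd1 := (circle1_snd K c).

Definition agree_off0 (v w : labelling0 K) : bool :=
  [forall i, (i \notin [:: fst0; snd0]) ==> (v i == w i)].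

(** This separates the two supports: among the [u] reached from [v], either all
or none are compatible with [w]. *)
Lemma agree_off_trans (v w : labelling0 K) (u : labelling K (one_state c)) :
  agree_off v u -> agree_off w u = agree_off0 v w.
Proof.
move=> /forallP vu; apply/forallP/forallP => vw i; apply/implyP => ni.
  have [a ia] := circle_ofP i; subst i.
  by move: (vu a) (vw a); rewrite ni /= => /eqP <-; rewrite eq_sym.
by move: (vu i) (vw (circle_of _ i)); rewrite ni /= => /eqP -> /eqP ->.
Qed.

(** A circle of the new resolution that avoids [c] is an old circle; it is found
through any of its arcs.  The default label [x] is never reached, since every
circle contains an arc. *)
Definition extend (v : labelling0 K) (x y : label) :
    labelling K (one_state c) :=
  [ffun B => if B == fst1 then x else if B == snd1 then y else
     if [pick a | circle_of (one_state c) a == B] is Some a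
     then v (circle_of (zero_state N) a) else x].

Lemma extend_fst v x y : extend v x y fst1 = x.
Proof. by rewrite ffunE eqxx. Qed.

Lemma extend_snd v x y : fst1 != snd1 -> extend v x y snd1 = y.
Proof. by rewrite ffunE eq_sym => /negPf ->; rewrite eqxx. Qed.

Lemma agree_off_extend v x y : agree_off v (extend v x y).
Proof.
apply/forallP => a; apply/implyP => na.
have := off_crossing (@zero_one_state _ c) na.
rewrite ffunE !inE negb_or => /andP [/negPf -> /negPf ->].
case: pickP => [b|/(_ a)]; last by rewrite eqxx.
rewrite eq_sym (eq_circle_off_crossing _ (@zero_one_state _ c) na).
by move=> /eqP ->.
Qed.

Lemma agree_off_inj v (u u' : labelling K (one_state c)) :
  agree_off v u -> agree_off v u' -> u fst1 = u' fst1 -> u snd1 = u' snd1 ->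
  u = u'.
Proof.
move=> /forallP vu /forallP vu' e1 e2; apply/ffunP => B.
have [->|n1] := eqVneq B fst1; first by [].
have [->|n2] := eqVneq B snd1; first by [].
have [a Ba] := circle_ofP B; subst B.
have nB : circle_of (one_state c) a \notin circles_at K (one_state c) c.
  by rewrite !inE negb_or n1.
have := off_crossing (@one_zero_state _ c) nB.
by move: (vu a) (vu' a) => + + na; rewrite na /= => /eqP -> /eqP ->.
Qed.

(** A labelling that agrees with [v] off the crossing amounts to the labels of
the new circles through it: one free label if they coincide, two otherwise. *)
Lemma sum_agree_off_eq (V : nmodType) v (F : label -> V) : fst1 = snd1 ->
  \sum_(u | agree_off (c := c) v u) F (u fst1) = \sum_x F x.
Proof.
move=> e; rewrite (reindex_onto (fun x => extend v x x) (fun u => u fst1)).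
  apply: eq_big => x; first by rewrite agree_off_extend extend_fst eqxx.
  by rewrite extend_fst.
move=> u vu; apply: (agree_off_inj (agree_off_extend _ _ _) vu); rewrite -?e;
  exact: extend_fst.
Qed.

Lemma sum_agree_off_neq (V : nmodType) v (F : label -> label -> V) :
  fst1 != snd1 ->
  \sum_(u | agree_off (c := c) v u) F (u fst1) (u snd1) =
  \sum_x \sum_y F x y.
Proof.
move=> ne; rewrite pair_big /=.
rewrite (reindex_onto (fun p => extend v p.1 p.2) (fun u => (u fst1, u snd1))).
  apply: eq_big => [[x y]|[x y] _] /=.
    by rewrite agree_off_extend extend_fst extend_snd ?eqxx.
  by rewrite extend_fst extend_snd.
move=> u vu; apply: (agree_off_inj (agree_off_extend _ _ _) vu).
  exact: extend_fst.
exact: extend_snd.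
Qed.

End LocalLabellings.

(** * The Laplacian of a single crossing *)

Section LocalLaplacian.
Variables (C : numClosedFieldType) (N : nat) (K : knot_diagram N) (c : 'I_N).

Notation fst0 := (circle0_fst K c).
Notation snd0 := (circle0_snd K c).

Definition local_laplacian (v w : labelling0 K) : C :=
  \sum_(u : labelling K (one_state c)) (edge_coef C v u)^* * edge_coef C w u.

Lemma local_laplacian_merging v w : merging K c ->
  local_laplacian v w =
  if agree_off0 c v w then
    \sum_x (merge_coef C (v fst0) (v snd0) x)^* *
           merge_coef C (w fst0) (w snd0) x
  else 0.
Proof.
move=> mc; have /andP [_ /eqP e] := mc.
rewrite /local_laplacian (bigID (agree_off v)) /= addrC big1 ?add0r.
  rewrite -(sum_agree_off_eq v _ e).
  case: ifP => vw; last apply: big1; [apply: eq_bigr|] => u vu;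
    by rewrite /edge_coef vu (agree_off_trans _ vu) vw mc ?mulr0.
by move=> u /negPf vu; rewrite /edge_coef vu rmorph0 mul0r.
Qed.

Lemma local_laplacian_splitting v w : splitting K c ->
  local_laplacian v w =
  if agree_off0 c v w then
    \sum_x \sum_y (split_coef C (v fst0) x y)^* * split_coef C (w fst0) x y
  else 0.
Proof.
move=> sc; have /andP [e ne] := sc.
have nm : merging K c = false by rewrite /merging e.
rewrite /local_laplacian (bigID (agree_off v)) /= addrC big1 ?add0r.
  rewrite -(sum_agree_off_neq v _ ne).
  case: ifP => vw; last apply: big1; [apply: eq_bigr|] => u vu;
    by rewrite /edge_coef vu (agree_off_trans _ vu) vw nm sc ?mulr0.
by move=> u /negPf vu; rewrite /edge_coef vu rmorph0 mul0r.
Qed.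

Lemma local_laplacian_other v w : ~~ merging K c -> ~~ splitting K c ->
  local_laplacian v w = 0.
Proof.
move=> /negPf nm /negPf ns; apply: big1 => u _.
by rewrite /edge_coef nm ns !if_same mulr0.
Qed.

(** The labelling [v] and its swap are the only candidates for a nonzero entry;
both are recognized by agreement off the crossing and two local labels, which
reduces the comparison of weights and coefficients to finitely many cases. *)
Lemma agree_off0_eq v w :
  (w == v) = [&& agree_off0 c v w, v fst0 == w fst0 & v snd0 == w snd0].
Proof.
apply/eqP/and3P => [->|[/forallP vw /eqP e1 /eqP e2]].
  by split => //; apply/forallP => i; rewrite eqxx implybT.
apply/ffunP => i; have [->|n1] := eqVneq i fst0; first by [].
have [->|n2] := eqVneq i snd0; first by [].
by have /implyP /(_ _)/eqP -> // := vw i; rewrite !inE negb_or n1.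
Qed.

Lemma agree_off0_swap v w :
  (w == swap fst0 snd0 v) =
  [&& agree_off0 c v w, v snd0 == w fst0 & v fst0 == w snd0].
Proof.
rewrite agree_off0_eq !ffunE tpermL tpermR; congr (_ && _).
apply: eq_forallb => i; rewrite !inE negb_or ffunE.
by case: tpermP => [->|->|_ _]; rewrite ?eqxx ?andbF.
Qed.

Lemma sum_merge_weight v (V : {set labelling0 K}) :
  v \in V -> swap fst0 snd0 v \in V ->
  \sum_(w in V) merge_weight C fst0 snd0 v w =
  match v fst0, v snd0 with
  | One, One => 2^-1
  | X, X => 0
  | _, _ => 1
  end.
Proof.
by move=> vV sV; rewrite /merge_weight; case: (v fst0); case: (v snd0);
  rewrite ?sum_indicator ?big1.
Qed.

(** In block form on the local labels 11, 1X, X1, XX, both sides are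
diag(1, J, 0), with J the 2 x 2 matrix of ones.  The two halves of the entry of
11 are the loop weight counted once in the degree and once in the adjacency. *)
Lemma merge_signless_laplace v w (V : {set labelling0 K}) :
  merging K c -> v \in V -> swap fst0 snd0 v \in V ->
  (\sum_(w' in V) merge_weight C fst0 snd0 v w') *+ (w == v) +
    merge_weight C fst0 snd0 v w = local_laplacian v w.
Proof.
move=> mc vV sV; rewrite sum_merge_weight // local_laplacian_merging //.
rewrite big_label /merge_weight agree_off0_eq agree_off0_swap.
case: (agree_off0 c v w) => /=; last first.
  by case: (v fst0); case: (v snd0); rewrite mulr0n addr0.
case: (v fst0); case: (v snd0); case: (w fst0); case: (w snd0) => /=;
  by rewrite ?rmorph0 ?rmorph1 ?mul0r ?mulr0 ?mul1r ?mulr0n ?mulr1n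
             ?addr0 ?add0r ?addr_half.
Qed.

(** Both sides are diag(2, 1) on the local labels 1, X: twice the loop weight. *)
Lemma split_signless_laplace v w (V : {set labelling0 K}) :
  splitting K c -> v \in V ->
  (\sum_(w' in V) split_weight C fst0 v w') *+ (w == v) +
    split_weight C fst0 v w = local_laplacian v w.
Proof.
move=> sc vV; rewrite local_laplacian_splitting //.
have /andP [/eqP e _] := sc.
rewrite !big_label /split_weight sum_indicator // agree_off0_eq -e andbb.
case: (agree_off0 c v w) => /=; last by rewrite mulr0n addr0.
case: (v fst0); case: (w fst0) => /=;
  by rewrite ?rmorph0 ?rmorph1 ?mul0r ?mulr0 ?mul1r ?mulr0n ?mulr1n
             ?addr0 ?add0r ?addr_half.
Qed.

End LocalLaplacian.

(** * Summing over the crossings *)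

Section SumOverCrossings.
Variables (C : numClosedFieldType) (N : nat) (K : knot_diagram N).

Lemma laplacian0_sum (v w : labelling0 K) :
  laplacian0 C K (enum_rank v) (enum_rank w) =
  \sum_(c < N) local_laplacian C c v w.
Proof.
rewrite mxE /local_laplacian sig_big_dep /=.
pose F (p : labelling1 K) :=
  (edge_coef C v (tagged p))^* * edge_coef C w (tagged p).
rewrite -[RHS]/(\sum_(p : labelling1 K) F p) (big_enum_val F).
by apply: eq_bigr => e _; rewrite !mxE !enum_rankK.
Qed.

Lemma nb_label_swap x i j (v : labelling0 K) :
  nb_label x (swap i j v) = nb_label x v.
Proof.
rewrite /nb_label -(card_imset [set a | v a == x] (@perm_inj _ (tperm i j))).
apply: eq_card => a; apply/idP/imsetP.
  by rewrite inE ffunE => va; exists (tperm i j a); rewrite ?inE ?tpermK.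
by case=> b; rewrite !inE => vb ->; rewrite ffunE tpermK.
Qed.

Lemma signless_laplace_entry n k (v w : labelling0 K) :
  let V := vertices (khovanov_graph C K n k) in v \in V ->
  (\sum_(w' in V) khovanov_weight C v w') *+ (w == v) + khovanov_weight C v w
  = \sum_(c < N) local_laplacian C c v w.
Proof.
move=> V vV; rewrite (bigID (merging K)) /=.
rewrite [X in _ = _ + X](bigID (splitting K)) /= [X in _ = _ + (_ + X)]big1.
  rewrite addr0 /khovanov_weight big_split /= mulrnDl.
  rewrite addrACA; congr (_ + _).
    rewrite exchange_big -sumrMnl -big_split /=; apply: eq_bigr => c mc.
    by apply: merge_signless_laplace => //; move: vV; rewrite !inE !nb_label_swap.
  rewrite exchange_big -sumrMnl -big_split /=.
  (* A splitting crossing is never merging. *)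
  apply: eq_big => c.
    by rewrite /merging /splitting; case: (_ == _); rewrite ?andbF.
  by move=> sc; apply: split_signless_laplace.
by move=> c /andP [nm ns]; apply: local_laplacian_other.
Qed.

End SumOverCrossings.

Theorem theorem28 (R : realType) (N l n k : nat) (K : knot_diagram N)
    (hl : #|circle K (zero_state N)| = l) (hnk : (n + k)%N = l) :
  let E := card_vertices_khovanov_graph R[i] hl hnk in
  castmx (E, E) (signless_laplace_mx (khovanov_graph R[i] K n k))
  = laplacian0_q R[i] K (k%:Z - n%:Z).
Proof.
move=> E; apply/matrixP => i j.
have VE : vertices (khovanov_graph R[i] K n k) = qbasis K (k%:Z - n%:Z).
  by apply: vertices_khovanov_graph; rewrite hl.
rewrite castmxE [RHS]mxE laplacian0_sum.
rewrite -!(enum_val_cast E _ VE) -(@signless_laplace_entry _ _ _ n k) ?enum_valP //.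
rewrite !mxE (inj_eq enum_val_inj) eq_sym; congr (_ *+ _ + _).
by rewrite (big_enum_val (khovanov_weight _ _)); apply: eq_bigr => a _; rewrite mxE.
Qed.
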